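(* Let $m>1$ and $z\in \mathbb C$ with $z \neq \phi, -\frac{1}{\phi}$, and $z\neq \frac{L_{n}}{L_{n-1}}$ for any $n\in \mathbb Z$. Define \[ \mathscr L_{m}(z):=\sum_{j=-\infty}^{\infty}(L_j z + L_{j-1})^{-m}, \] where the $L_n$ are Lucas numbers, $n\in \mathbb Z$. Then for $k\geq 1$ we have: (i) $\mathscr L_{2k}(-\frac{1}{z})=z^{2k}\mathscr L_{2k}(z)$; (ii) $\mathscr L_{2k}(1-z)=\mathscr L_{2k}(z)$.
   Context: The Lucas numbers $L_n$ are defined by $L_0:=2$, $L_1:=1$, and $L_n:=L_{n-1}+L_{n-2}$ for $n\geq 2$; they are extended to negative indices by $L_{-n}:=(-1)^nL_n$ for $n\geq 1$. Here $\phi:=\frac{1+\sqrt5}{2}$ is the golden ratio, and $\lim_{n\to\infty}L_n/L_{n-1}=\phi$. The series converges on its domain for $m>1$; the points $z=L_n/L_{n-1}$ give poles of order $m$, and $\phi$, $-1/\phi$ are limits of these poles (essential singularities). *)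

(* Defs.v *)
(* Stdlib real numbers, with Coquelicot's complex numbers [C]. *)
From Stdlib Require Import Reals ZArith.
From Coquelicot Require Import Coquelicot.

Fixpoint lucas_nat (n : nat) : Z :=
  match n with
  | O => 2
  | S p => match p with
           | O => 1
           | S q => (lucas_nat p + lucas_nat q)%Z
           end
  end.

Definition lucas (n : Z) : Z :=
  if (0 <=? n)%Z then lucas_nat (Z.to_nat n)
  else ((-1) ^ (- n) * lucas_nat (Z.to_nat (- n)))%Z.

(* Coerced to [C] through [RtoC] where needed. *)
Definition lucasR (n : Z) : R := IZR (lucas n).

Definition golden : R := ((1 + sqrt 5) / 2)%R.

(* A two-sided series converges when its halves over j >= 0 and over j < 0
   converge separately (not merely in the sense of symmetric partial sums). *)
Definition is_bilateral_series (a : Z -> C) (l : C) : Prop :=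
  exists lp ln : C,
    is_series (K := C_AbsRing) (V := C_NormedModule)
      (fun n : nat => a (Z.of_nat n)) lp /\
    is_series (K := C_AbsRing) (V := C_NormedModule)
      (fun n : nat => a (- Z.of_nat (S n))%Z) ln /\
    l = (lp + ln)%C.

Definition ex_bilateral_series (a : Z -> C) : Prop :=
  exists l : C, is_bilateral_series a l.

(* The sum when the series converges; an unspecified value otherwise. *)
Definition BilateralSeries (a : Z -> C) : C :=
  iota (T := C_CompleteNormedModule) (is_bilateral_series a).

Definition lucas_term (m : nat) (z : C) (j : Z) : C :=
  (/ (lucasR j * z + lucasR (j - 1)) ^ m)%C.

Definition lucas_series (m : nat) (z : C) : C :=
  BilateralSeries (lucas_term m z).

(* Lucas numbers with integer index never vanish, so the quotients are genuine. *)
Definition lucas_domain (z : C) : Prop :=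
  z <> RtoC golden /\
  z <> RtoC (- 1 / golden)%R /\
  forall n : Z, z <> RtoC (lucasR n / lucasR (n - 1))%R.

(* Main.v *)
(** Since [L_(-j) = (-1)^j L_j], the linear form [l_j(z) = L_j z + L_(j-1)] satisfies
    [l_j(1 - z) = - (-1)^j l_(-j)(z)] and [z l_j(-1/z) = - (-1)^j l_(1-j)(z)].
    For even exponents the signs disappear, and the functional equations amount to
    reindexing the sum by [j -> -j] and [j -> 1 - j].  By Binet's formula [l_(n+1)(z)] is
    [phi^n (phi z + 1)] plus a bounded term, so the half [j >= 0] converges
    geometrically; the half [j < 0] has the absolute values of the other one at [1 - z]. *)

Require Import Defs.
From Stdlib Require Import Reals ZArith Lra Lia.
From Coquelicot Require Import Coquelicot.

Open Scope R_scope.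

(** * Two-sided series: uniqueness, scaling and reindexing *)

Definition is_Cseries (a : nat -> C) (l : C) : Prop :=
  is_series (K := C_AbsRing) (V := C_NormedModule) a l.

Lemma is_Cseries_unique (a : nat -> C) (l l' : C) :
  is_Cseries a l -> is_Cseries a l' -> l = l'.
Proof.
  intros H H'.
  exact (filterlim_locally_unique (K := C_AbsRing) (V := C_NormedModule) _ l l' H H').
Qed.

Lemma is_Cseries_ext (a b : nat -> C) (l : C) :
  (forall n, a n = b n) -> is_Cseries a l -> is_Cseries b l.
Proof. apply is_series_ext. Qed.

Lemma is_Cseries_tail (a : nat -> C) (l : C) :
  is_Cseries a l -> is_Cseries (fun n => a (S n)) (l - a 0%nat)%C.
Proof.
  intros H. apply (is_series_incr_1 (V := C_NormedModule)).
  replace (plus _ _) with l; [exact H|].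
  change (l = l - a 0%nat + a 0%nat)%C. ring.
Qed.

Lemma is_Cseries_cons (a : nat -> C) (l : C) :
  is_Cseries (fun n => a (S n)) l -> is_Cseries a (l + a 0%nat)%C.
Proof.
  intros H. apply (is_series_decr_1 (V := C_NormedModule)).
  replace (plus _ _) with l; [exact H|].
  change (l = l + a 0%nat + - a 0%nat)%C. ring.
Qed.

Lemma is_bilateral_series_unique (a : Z -> C) (l l' : C) :
  is_bilateral_series a l -> is_bilateral_series a l' -> l = l'.
Proof.
  intros (p & n & Hp & Hn & ->) (p' & n' & Hp' & Hn' & ->).
  rewrite (is_Cseries_unique _ _ _ Hp Hp'), (is_Cseries_unique _ _ _ Hn Hn').
  reflexivity.
Qed.

Lemma BilateralSeries_unique (a : Z -> C) (l : C) :
  is_bilateral_series a l -> BilateralSeries a = l.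
Proof.
  intros H. apply (iota_unique (V := C_CompleteNormedModule)); [|exact H].
  intros l' H'. exact (is_bilateral_series_unique a l' l H' H).
Qed.

Lemma BilateralSeries_correct (a : Z -> C) :
  ex_bilateral_series a -> is_bilateral_series a (BilateralSeries a).
Proof. intros [l H]. now rewrite (BilateralSeries_unique a l H). Qed.

Lemma is_bilateral_series_ext (a b : Z -> C) (l : C) :
  (forall j, a j = b j) -> is_bilateral_series a l -> is_bilateral_series b l.
Proof.
  intros E (p & n & Hp & Hn & ->). exists p, n. repeat split.
  - apply is_Cseries_ext with (2 := Hp). intros; apply E.
  - apply is_Cseries_ext with (2 := Hn). intros; apply E.
Qed.

Lemma is_bilateral_series_scal (c : C) (a : Z -> C) (l : C) :
  is_bilateral_series a l -> is_bilateral_series (fun j => c * a j)%C (c * l)%C.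
Proof.
  intros (p & n & Hp & Hn & ->). exists (c * p)%C, (c * n)%C. repeat split.
  - exact (is_series_scal (V := C_NormedModule) c _ _ Hp).
  - exact (is_series_scal (V := C_NormedModule) c _ _ Hn).
  - ring.
Qed.

(** The two halves trade places, except that [a 0] must move to the new nonnegative half; it cancels
    in the total. *)
Lemma is_bilateral_series_opp (a : Z -> C) (l : C) :
  is_bilateral_series a l -> is_bilateral_series (fun j => a (- j)%Z) l.
Proof.
  intros (p & n & Hp & Hn & ->). exists (n + a 0%Z)%C, (p - a 0%Z)%C. repeat split.
  - exact (is_Cseries_cons (fun k => a (- Z.of_nat k)%Z) n Hn).
  - apply is_Cseries_ext with (2 := is_Cseries_tail _ _ Hp).
    intros k. now rewrite Z.opp_involutive.
  - ring.
Qed.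

(** The shift moves [a 0] from the nonnegative half to index -1 of the negative one. *)
Lemma is_bilateral_series_succ (a : Z -> C) (l : C) :
  is_bilateral_series a l -> is_bilateral_series (fun j => a (j + 1)%Z) l.
Proof.
  intros (p & n & Hp & Hn & ->). exists (p - a 0%Z)%C, (n + a 0%Z)%C. repeat split.
  - apply is_Cseries_ext with (2 := is_Cseries_tail _ _ Hp).
    intros k. f_equal. lia.
  - apply is_Cseries_ext with (a := fun k => a (- Z.of_nat k)%Z).
    + intros k. f_equal. lia.
    + exact (is_Cseries_cons (fun k => a (- Z.of_nat k)%Z) n Hn).
  - ring.
Qed.

Lemma is_bilateral_series_reflect (a : Z -> C) (l : C) :
  is_bilateral_series a l -> is_bilateral_series (fun j => a (1 - j)%Z) l.
Proof.
  intros H. apply is_bilateral_series_succ, is_bilateral_series_opp in H.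
  apply is_bilateral_series_ext with (2 := H).
  intros j. f_equal. lia.
Qed.

(** * Lucas numbers of integer index: sign rule, nonvanishing, recurrence *)

Definition altsign (n : Z) : R := if Z.even n then 1 else -1.

Lemma altsign_succ (n : Z) : altsign (n + 1) = - altsign n.
Proof.
  unfold altsign. rewrite Z.even_add. destruct (Z.even n); simpl; lra.
Qed.

Lemma altsign_pred (n : Z) : altsign (n - 1) = - altsign n.
Proof. rewrite <- (Z.sub_add 1 n) at 2. rewrite altsign_succ. lra. Qed.

Lemma altsign_cases (n : Z) : altsign n = 1 \/ altsign n = -1.
Proof. unfold altsign. destruct (Z.even n); auto. Qed.

Lemma lucas_nat_pos (n : nat) : (0 < lucas_nat n /\ 0 < lucas_nat (S n))%Z.
Proof.
  induction n as [|n [H1 H2]]; [split; reflexivity|].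
  split; [exact H2|].
  change (lucas_nat (S (S n))) with (lucas_nat (S n) + lucas_nat n)%Z. lia.
Qed.

Lemma lucasR_of_nat (n : nat) : lucasR (Z.of_nat n) = IZR (lucas_nat n).
Proof.
  unfold lucasR, lucas.
  destruct (Z.leb_spec 0 (Z.of_nat n)); [|lia]. now rewrite Nat2Z.id.
Qed.

(** Links the parity form, valid for every integer, with the power used in [lucas]; a power in [Z]
    would be 0 at negative exponents. *)
Lemma altsign_of_nat (n : nat) : altsign (Z.of_nat n) = IZR ((-1) ^ Z.of_nat n).
Proof.
  induction n as [|n IH]; [reflexivity|].
  rewrite Nat2Z.inj_succ, Z.pow_succ_r by lia.
  unfold Z.succ. rewrite altsign_succ, IH, mult_IZR. lra.
Qed.

Lemma lucasR_opp_of_nat (n : nat) :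
  lucasR (- Z.of_nat n) = altsign (Z.of_nat n) * lucasR (Z.of_nat n).
Proof.
  (* At 0 the negated index still falls in the nonnegative branch of [lucas], so this case is
     separate. *)
  destruct n as [|n]; [unfold altsign; simpl; lra|].
  rewrite lucasR_of_nat, altsign_of_nat, <- mult_IZR.
  unfold lucasR, lucas.
  destruct (Z.leb_spec 0 (- Z.of_nat (S n))); [lia|].
  now rewrite Z.opp_involutive, Nat2Z.id.
Qed.

Lemma altsign_opp (n : Z) : altsign (- n) = altsign n.
Proof. unfold altsign. now rewrite Z.even_opp. Qed.

Lemma altsign_sqr (n : Z) : altsign n * altsign n = 1.
Proof. destruct (altsign_cases n) as [-> | ->]; lra. Qed.

Lemma lucasR_opp (n : Z) : lucasR (- n) = altsign n * lucasR n.
Proof.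
  destruct (Z_le_gt_dec 0 n) as [H|H].
  - rewrite <- (Z2Nat.id n) by lia. apply lucasR_opp_of_nat.
  - assert (E := lucasR_opp_of_nat (Z.to_nat (- n))).
    rewrite Z2Nat.id, Z.opp_involutive, altsign_opp in E by lia.
    rewrite E, <- Rmult_assoc, altsign_sqr. lra.
Qed.

Lemma lucasR_neq0 (n : Z) : lucasR n <> 0.
Proof.
  assert (H : forall k : nat, lucasR (Z.of_nat k) <> 0).
  { intros k. rewrite lucasR_of_nat. apply not_0_IZR.
    destruct (lucas_nat_pos k). lia. }
  destruct (Z_le_gt_dec 0 n).
  - rewrite <- (Z2Nat.id n) by lia. apply H.
  - rewrite <- (Z.opp_involutive n), lucasR_opp, <- (Z2Nat.id (- n)) by lia.
    intros E. apply Rmult_integral in E as [E|E]; [|now apply H in E].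
    destruct (altsign_cases (Z.of_nat (Z.to_nat (- n)))); lra.
Qed.

Lemma lucasR_rec_of_nat (n : nat) :
  lucasR (Z.of_nat n + 2) = lucasR (Z.of_nat n + 1) + lucasR (Z.of_nat n).
Proof.
  replace (Z.of_nat n + 2)%Z with (Z.of_nat (S (S n))) by lia.
  replace (Z.of_nat n + 1)%Z with (Z.of_nat (S n)) by lia.
  rewrite !lucasR_of_nat, <- plus_IZR. reflexivity.
Qed.

Lemma lucasR_rec (n : Z) : lucasR (n + 1) = lucasR n + lucasR (n - 1).
Proof.
  destruct (Z_le_gt_dec 1 n) as [H|H].
  - assert (E := lucasR_rec_of_nat (Z.to_nat (n - 1))).
    rewrite Z2Nat.id in E by lia.
    now replace (n - 1 + 2)%Z with (n + 1)%Z in E by lia;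
      replace (n - 1 + 1)%Z with n in E by lia.
  (* For [n = 0] the claim is 1 = 2 + (-1). For [n < 0] it is the recurrence at the natural number
     [- n - 1], carried back by the sign rule. *)
  - destruct (Z.eq_dec n 0) as [-> | H0].
    + unfold lucasR. rewrite <- plus_IZR. reflexivity.
    + assert (E := lucasR_rec_of_nat (Z.to_nat (- n - 1))).
      rewrite Z2Nat.id in E by lia.
      replace (- n - 1 + 2)%Z with (- (n - 1))%Z in E by lia.
      replace (- n - 1 + 1)%Z with (- n)%Z in E by lia.
      replace (- n - 1)%Z with (- (n + 1))%Z in E by lia.
      rewrite !lucasR_opp, altsign_pred, altsign_succ in E.
      destruct (altsign_cases n) as [S|S]; rewrite S in E; lra.
Qed.

(** * The golden ratio and Binet's formula *)

Lemma golden_sqr : golden * golden = golden + 1.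
Proof.
  unfold golden. assert (H := sqrt_sqrt 5 ltac:(lra)). lra.
Qed.

Lemma golden_bounds : 3 / 2 < golden < 2.
Proof.
  unfold golden.
  assert (H := sqrt_sqrt 5 ltac:(lra)). assert (P := sqrt_pos 5). nra.
Qed.

(** The two roots of x^2 = x + 1 have product -1 and sum 1. *)
Lemma golden_conj : -1 / golden = 1 - golden.
Proof.
  assert (H := golden_bounds). assert (E := golden_sqr).
  apply Rmult_eq_reg_l with golden; [|lra]. field_simplify; [|lra]. nra.
Qed.

(** Both [golden] and [1 - golden] satisfy x^2 = x + 1, so their powers obey the Lucas recurrence.
    Two consecutive indices are carried along because the recurrence has order two. *)
Lemma lucas_binet (n : nat) :
  lucasR (Z.of_nat n) = golden ^ n + (1 - golden) ^ n /\
  lucasR (Z.of_nat (S n)) = golden ^ S n + (1 - golden) ^ S n.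
Proof.
  induction n as [|n [H1 H2]].
  - split; rewrite lucasR_of_nat; simpl; lra.
  - split; [exact H2|].
    replace (Z.of_nat (S (S n))) with (Z.of_nat n + 2)%Z by lia.
    rewrite lucasR_rec_of_nat.
    replace (Z.of_nat n + 1)%Z with (Z.of_nat (S n)) by lia.
    rewrite H1, H2. simpl.
    transitivity ((golden + 1) * golden ^ n +
                  (1 - golden + 1) * (1 - golden) ^ n); [ring|].
    rewrite <- golden_sqr.
    replace (1 - golden + 1) with ((1 - golden) * (1 - golden))
      by (assert (E := golden_sqr); lra).
    ring.
Qed.

(** * Symmetries of the linear form *)

Definition lucas_form (z : C) (j : Z) : C := (lucasR j * z + lucasR (j - 1))%C.

(** By the recurrence the left side is L_(j+1) - L_j z; the sign rule turns both coefficients into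
    those of index [- j]. *)
Lemma lucas_form_one_minus (z : C) (j : Z) :
  lucas_form (1 - z) j = (- altsign j * lucas_form z (- j))%C.
Proof.
  unfold lucas_form.
  replace (- j - 1)%Z with (- (j + 1))%Z by lia.
  rewrite !lucasR_opp, altsign_succ, lucasR_rec.
  rewrite !RtoC_mult, RtoC_opp, RtoC_plus.
  destruct (altsign_cases j) as [-> | ->]; ring.
Qed.

(** Multiplying the left side by z gives L_(j-1) z - L_j: the coefficients swap roles, and the sign
    rule matches them with index [1 - j]. *)
Lemma lucas_form_neg_inv (z : C) (j : Z) :
  z <> 0 ->
  lucas_form (- (1 / z)) j = (- altsign j * lucas_form z (1 - j) / z)%C.
Proof.
  intros hz. unfold lucas_form.
  replace (1 - j)%Z with (- (j - 1))%Z by lia.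
  replace (- (j - 1) - 1)%Z with (- j)%Z by lia.
  rewrite !lucasR_opp, altsign_pred, !RtoC_mult, RtoC_opp.
  destruct (altsign_cases j) as [-> | ->]; field; exact hz.
Qed.

(** * Invariance of the domain under both substitutions *)

Lemma lucas_ratio_neg_inv (n : Z) :
  - / (lucasR n / lucasR (n - 1)) = lucasR (1 - n) / lucasR (1 - n - 1).
Proof.
  replace (1 - n)%Z with (- (n - 1))%Z by lia.
  replace (- (n - 1) - 1)%Z with (- n)%Z by lia.
  rewrite !lucasR_opp, altsign_pred.
  assert (H := lucasR_neq0 n). assert (H' := lucasR_neq0 (n - 1)).
  destruct (altsign_cases n) as [-> | ->]; field; auto.
Qed.

Lemma lucas_ratio_one_minus (n : Z) :
  1 - lucasR n / lucasR (n - 1) = lucasR (2 - n) / lucasR (2 - n - 1).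
Proof.
  assert (E := lucasR_rec (n - 1)).
  replace (n - 1 + 1)%Z with n in E by lia.
  replace (2 - n)%Z with (- (n - 1 - 1))%Z by lia.
  replace (- (n - 1 - 1) - 1)%Z with (- (n - 1))%Z by lia.
  rewrite !lucasR_opp, !altsign_pred, E.
  assert (H' := lucasR_neq0 (n - 1)).
  destruct (altsign_cases n) as [-> | ->]; field; auto.
Qed.

Lemma RtoC_neq0 (r : R) : r <> 0 -> RtoC r <> 0.
Proof. intros H E. now apply RtoC_inj in E. Qed.

(** The map z -> -1/z is an involution, so an excluded value of -1/z becomes a value of z. *)
Lemma neg_inv_eq_RtoC (z : C) (r : R) :
  z <> 0 -> r <> 0 -> (- (1 / z))%C = r -> z = RtoC (- / r).
Proof.
  intros hz hr E. rewrite RtoC_opp, RtoC_inv by exact hr.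
  apply RtoC_neq0 in hr.
  transitivity ((- (1 / z)) * z / r)%C; [rewrite E|]; field; auto.
Qed.

(** The substitution swaps the two limit points and permutes the Lucas quotients by n -> 1 - n. *)
Lemma lucas_domain_neg_inv (z : C) :
  z <> 0 -> lucas_domain z -> lucas_domain (- (1 / z))%C.
Proof.
  intros hz (H1 & H2 & H3). assert (G := golden_bounds).
  assert (G' : -1 / golden <> 0) by (rewrite golden_conj; lra).
  repeat split.
  - intros E. apply neg_inv_eq_RtoC in E; [|auto|lra]. apply H2.
    rewrite E. f_equal. field. lra.
  - intros E. apply neg_inv_eq_RtoC in E; auto. apply H1.
    rewrite E. f_equal. field. lra.
  - intros n E. apply neg_inv_eq_RtoC in E; auto.
    + apply (H3 (1 - n)%Z). now rewrite <- lucas_ratio_neg_inv.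
    + apply Rmult_integral_contrapositive_currified;
        [|apply Rinv_neq_0_compat]; apply lucasR_neq0.
Qed.

(** Again the two limit points are swapped, since they add up to 1; the quotients are permuted by n
    -> 2 - n. *)
Lemma lucas_domain_one_minus (z : C) : lucas_domain z -> lucas_domain (1 - z)%C.
Proof.
  intros (H1 & H2 & H3).
  assert (E0 : forall r : R, (1 - z)%C = r -> z = RtoC (1 - r)).
  { intros r E. rewrite RtoC_minus, <- E. ring. }
  repeat split.
  - intros E. apply H2. rewrite golden_conj. now apply E0.
  - intros E. apply H1. rewrite (E0 _ E), golden_conj. f_equal. ring.
  - intros n E. apply (H3 (2 - n)%Z). rewrite <- lucas_ratio_one_minus. now apply E0.
Qed.

(** The only zero of the form is -L_(j-1)/L_j, which is the excluded quotient of index [1 - j]. *)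
Lemma lucas_form_neq0 (z : C) (j : Z) : lucas_domain z -> lucas_form z j <> 0.
Proof.
  intros (_ & _ & H) E. apply (H (1 - j)%Z).
  assert (N := lucasR_neq0 j). assert (N' := lucasR_neq0 (j - 1)).
  rewrite <- lucas_ratio_neg_inv.
  replace (- / (lucasR j / lucasR (j - 1))) with (- lucasR (j - 1) / lucasR j)
    by (field; auto).
  rewrite RtoC_div, RtoC_opp by exact N.
  apply RtoC_neq0 in N. unfold lucas_form in E.
  transitivity ((lucasR j * z + lucasR (j - 1) - lucasR (j - 1)) / lucasR j)%C;
    [field; exact N|].
  rewrite E. field. exact N.
Qed.

(** * Growth of the linear form and absolute convergence *)

Lemma lucas_form_binet (z : C) (n : nat) :
  lucas_form z (Z.of_nat (S n)) =
  ((golden ^ n)%R * (golden * z + 1) +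
   ((1 - golden) ^ n)%R * ((1 - golden)%R * z + 1))%C.
Proof.
  unfold lucas_form. destruct (lucas_binet n) as [H1 H2].
  replace (Z.of_nat (S n) - 1)%Z with (Z.of_nat n) by lia.
  rewrite H1, H2. simpl pow.
  rewrite !RtoC_plus, !RtoC_mult. ring.
Qed.

(** As z differs from -1/phi, the coefficient [A] of phi^n is nonzero, while |1 - phi| < 1 keeps the
    conjugate term below |B|. The main term therefore wins. *)
Lemma lucas_form_growth (z : C) :
  lucas_domain z ->
  exists c : R, exists N : nat, 0 < c /\
    forall n : nat, (N <= n)%nat -> c * golden ^ n <= Cmod (lucas_form z (Z.of_nat n)).
Proof.
  intros (_ & H & _). assert (G := golden_bounds).
  set (A := (golden * z + 1)%C). set (B := ((1 - golden)%R * z + 1)%C).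
  assert (gz : RtoC golden <> 0) by (apply RtoC_neq0; lra).
  assert (HA : 0 < Cmod A).
  { apply Cmod_gt_0. intros E. apply H.
    rewrite RtoC_div by lra. replace (RtoC (-1)) with (- (1))%C by (rewrite <- RtoC_opp; reflexivity).
    transitivity ((A - 1) / golden)%C; [unfold A; field; exact gz|].
    rewrite E. field. exact gz. }
  (* From this [N] on, the conjugate term is at most half of the main term. *)
  destruct (Pow_x_infinity golden) with (b := 2 * Cmod B / Cmod A) as [N HN].
  { rewrite Rabs_right; lra. }
  (* The 2 pays for the lost half; the extra [golden] and the successor absorb the shift, as the
     form at [S n] grows like phi^n. *)
  exists (Cmod A / (2 * golden)), (S N). split.
  { apply Rdiv_lt_0_compat; lra. }
  intros [|n] Hn; [lia|].
  rewrite lucas_form_binet. fold A B.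
  specialize (HN n ltac:(lia)).
  assert (Gn : 0 < golden ^ n) by (apply pow_lt; lra).
  rewrite Rabs_right in HN by lra.
  assert (HB : 2 * Cmod B <= golden ^ n * Cmod A).
  { apply Rge_le in HN; apply Rmult_le_compat_r with (r := Cmod A) in HN; [|lra].
    unfold Rdiv in HN. rewrite Rmult_assoc, Rinv_l in HN; lra. }
  assert (P : Cmod (((1 - golden) ^ n)%R * B) <= Cmod B).
  { rewrite Cmod_mult, Cmod_R.
    assert (Rabs ((1 - golden) ^ n) <= 1).
    { rewrite <- RPow_abs. apply Rle_trans with (1 ^ n); [|rewrite pow1; lra].
      apply pow_incr.
      split; [apply Rabs_pos|]. apply Rabs_le. lra. }
    assert (Q := Cmod_ge_0 B). nra. }
  (* Reverse triangle inequality: the main term is the whole form minus the conjugate term. *)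
  assert (T := Cmod_triangle ((golden ^ n)%R * A + ((1 - golden) ^ n)%R * B)
                             (- (((1 - golden) ^ n)%R * B))).
  rewrite Cmod_opp in T.
  replace ((golden ^ n)%R * A + ((1 - golden) ^ n)%R * B
           + - (((1 - golden) ^ n)%R * B))%C with ((golden ^ n)%R * A)%C in T by ring.
  rewrite Cmod_mult, Cmod_R, Rabs_right in T by lra.
  replace (Cmod A / (2 * golden) * golden ^ S n) with (golden ^ n * Cmod A / 2)
    by (simpl; field; lra).
  lra.
Qed.

Lemma ex_series_lucas_term_nonneg (m : nat) (z : C) :
  (1 <= m)%nat -> lucas_domain z ->
  ex_series (fun n : nat => Cmod (lucas_term m z (Z.of_nat n))).
Proof.
  intros Hm Hz. destruct (lucas_form_growth z Hz) as (c & N & Hc & H).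
  assert (G := golden_bounds).
  (* The growth bound starts at [N]; beyond it the terms are dominated by a geometric series of
     ratio phi^(-m) < 1. *)
  apply (ex_series_incr_n _ N).
  apply (ex_series_le (K := R_AbsRing) (V := R_CompleteNormedModule))
    with (b := fun n => scal ((/ (c * golden ^ N)) ^ m) ((/ golden ^ m) ^ n)).
  - intros n. change (norm ?x) with (Rabs x). change (scal ?x ?y) with (x * y).
    rewrite Rabs_right by (apply Rle_ge, Cmod_ge_0).
    unfold lucas_term. fold (lucas_form z (Z.of_nat (N + n))).
    rewrite Cmod_inv, Cmod_pow by (apply Cpow_nz, lucas_form_neq0, Hz).
    replace ((/ (c * golden ^ N)) ^ m * (/ golden ^ m) ^ n)
      with (/ (c * golden ^ (N + n)) ^ m).
    + apply Rinv_le_contravar.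
      * apply pow_lt, Rmult_lt_0_compat, pow_lt; lra.
      * apply pow_incr. split; [|apply H; lia].
        left. apply Rmult_lt_0_compat, pow_lt; lra.
    + rewrite !pow_inv, <- Rinv_mult, pow_add. f_equal.
      rewrite !Rpow_mult_distr, <- !pow_mult, (Nat.mul_comm n m). ring.
  - apply (ex_series_scal (V := R_NormedModule)), ex_series_geom.
    assert (1 < golden ^ m) by (apply Rlt_pow_R1; [lra|lia]).
    rewrite Rabs_right by (left; apply Rinv_0_lt_compat; lra).
    rewrite <- Rinv_1. apply Rinv_lt_contravar; lra.
Qed.

Lemma Cmod_altsign (n : Z) : Cmod (altsign n) = 1.
Proof.
  rewrite Cmod_R. destruct (altsign_cases n) as [-> | ->];
    [apply Rabs_R1 | rewrite Rabs_left; lra].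
Qed.

(** The sign relating the two forms has modulus 1, so this holds for every exponent, odd ones
    included; it transfers convergence to the negative half. *)
Lemma Cmod_lucas_term_opp (m : nat) (z : C) (j : Z) :
  lucas_domain z -> Cmod (lucas_term m z (- j)) = Cmod (lucas_term m (1 - z) j).
Proof.
  intros Hz. assert (Hz' := lucas_domain_one_minus z Hz).
  unfold lucas_term. fold (lucas_form z (- j)) (lucas_form (1 - z) j).
  rewrite !Cmod_inv, !Cmod_pow by (apply Cpow_nz, lucas_form_neq0; assumption).
  now rewrite lucas_form_one_minus, Cmod_mult, Cmod_opp, Cmod_altsign, Rmult_1_l.
Qed.

Lemma ex_bilateral_lucas_term (m : nat) (z : C) :
  (1 <= m)%nat -> lucas_domain z -> ex_bilateral_series (lucas_term m z).
Proof.
  intros Hm Hz.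
  destruct (ex_series_le (K := C_AbsRing) (V := C_CompleteNormedModule)
              (fun n => lucas_term m z (Z.of_nat n)) _
              (fun n => Rle_refl _) (ex_series_lucas_term_nonneg m z Hm Hz)) as [p Hp].
  assert (Hneg := ex_series_lucas_term_nonneg m _ Hm (lucas_domain_one_minus z Hz)).
  (* The negative half begins at index -1, so the term of index 0 at [1 - z] is dropped. *)
  apply ex_series_incr_1 in Hneg.
  destruct (ex_series_le (K := C_AbsRing) (V := C_CompleteNormedModule)
              (fun n => lucas_term m z (- Z.of_nat (S n))) _
              (fun n => Req_le _ _ (Cmod_lucas_term_opp m z _ Hz)) Hneg) as [n Hn].
  exists (p + n)%C, p, n. auto.
Qed.

(** * Even exponents and the functional equations *)

Lemma altsign_pow_even (n : Z) (k : nat) : ((- altsign n) ^ (2 * k))%C = 1.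
Proof.
  rewrite Cpow_mult_r. replace ((- altsign n) ^ 2)%C with (RtoC 1).
  - apply Cpow_1_l.
  - destruct (altsign_cases n) as [-> | ->]; simpl; ring.
Qed.

Lemma lucas_term_one_minus (k : nat) (z : C) (j : Z) :
  lucas_term (2 * k) (1 - z) j = lucas_term (2 * k) z (- j).
Proof.
  unfold lucas_term. fold (lucas_form z (- j)) (lucas_form (1 - z) j).
  rewrite lucas_form_one_minus, Cpow_mult_l, altsign_pow_even. now rewrite Cmult_1_l.
Qed.

Lemma lucas_term_neg_inv (k : nat) (z : C) (j : Z) :
  z <> 0 -> lucas_domain z ->
  lucas_term (2 * k) (- (1 / z)) j = (z ^ (2 * k) * lucas_term (2 * k) z (1 - j))%C.
Proof.
  intros hz Hz. assert (W := lucas_form_neq0 z (1 - j) Hz).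
  unfold lucas_term. fold (lucas_form z (1 - j)) (lucas_form (- (1 / z)) j).
  rewrite lucas_form_neg_inv by exact hz.
  unfold Cdiv.
  rewrite !Cpow_mult_l, altsign_pow_even, Cmult_1_l, Cpow_inv by exact hz.
  field. split; apply Cpow_nz; assumption.
Qed.

Theorem theorem2 (z : C) (hz : lucas_domain z) :
  (forall m : nat, (1 < m)%nat -> ex_bilateral_series (lucas_term m z)) /\
  (forall k : nat, (1 <= k)%nat ->
    (z <> RtoC 0 ->
       lucas_domain (- (1 / z))%C /\
       lucas_series (2 * k) (- (1 / z))%C
         = (z ^ (2 * k) * lucas_series (2 * k) z)%C) /\
    (lucas_domain (1 - z)%C /\
     lucas_series (2 * k) (1 - z)%C = lucas_series (2 * k) z)).
Proof.
  split.
  { intros m Hm. apply ex_bilateral_lucas_term; [lia|exact hz]. }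
  intros k Hk.
  (* Convergence ensures that [BilateralSeries] is the true sum here; by uniqueness, each equation
     then only needs this sum to be reindexed, and scaled in the first case. *)
  assert (S := BilateralSeries_correct _ (ex_bilateral_lucas_term (2 * k) z ltac:(lia) hz)).
  split; [intros nz; split|split].
  - now apply lucas_domain_neg_inv.
  - apply BilateralSeries_unique.
    apply is_bilateral_series_ext
      with (2 := is_bilateral_series_scal _ _ _ (is_bilateral_series_reflect _ _ S)).
    intros j. now rewrite lucas_term_neg_inv.
  - now apply lucas_domain_one_minus.
  - apply BilateralSeries_unique.
    apply is_bilateral_series_ext with (2 := is_bilateral_series_opp _ _ S).
    intros j. now rewrite lucas_term_one_minus.
Qed.
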